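(* Let $(A,\cdot,\Delta_A)$ be a left-symmetric bialgebra, $V$ a vector space, and let linear maps $\rightharpoonup:V\otimes A\to A$, $\leftharpoonup:A\otimes V\to A$, $\triangleleft:V\otimes A\to V$, $\triangleright:A\otimes V\to V$, $\sigma:V\otimes V\to A$, $\cdot_V:V\otimes V\to V$ (written $xy$), $\rho:V\to A\otimes V$, $\gamma:V\to V\otimes A$, $Q:V\to A\otimes A$, $\Delta_V:V\to V\otimes V$ be given. On $E=A\oplus V$ consider the product $$(a,x)(b,y)=\big(ab+x\rightharpoonup b+a\leftharpoonup y+\sigma(x,y),\;xy+x\triangleleft b+a\triangleright y\big)$$ and coproduct $\Delta_E(a)=\Delta_A(a)$, $\Delta_E(x)=\Delta_V(x)+\rho(x)+\gamma(x)+Q(x)$. Then $E$ is a left-symmetric bialgebra if and only if $E$ with this product is a left-symmetric algebra, $E$ with this coproduct is a left-symmetric coalgebra, and for all $a,b\in A$, $x,y\in V$: 1. $\rho([x,y])=x_{[-1]}\otimes[x_{[0]},y]+(x\rightharpoonup y_{[-1]})\otimes y_{[0]}+x_{\{1\}}\otimes(x_{\{2\}}\triangleright y)+\sigma(x,y_1)\otimes y_2+y_{[-1]}\otimes[x,y_{[0]}]+y_{\{1\}}\otimes(x\triangleleft y_{\{2\}})-(y\rightharpoonup x_{[-1]})\otimes x_{[0]}-y_{\{1\}}\otimes(y_{\{2\}}\triangleright x)-\sigma(y,x_1)\otimes x_2-x_{\{1\}}\otimes(y\triangleleft x_{\{2\}})$; 2. $\gamma([x,y])=x_{[0]}\otimes(x_{[1]}\leftharpoonup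 y)+xy_{[0]}\otimes y_{[1]}+x_1\otimes\sigma(x_2,y)+(x\triangleleft y_{\{1\}})\otimes y_{\{2\}}+y_1\otimes\sigma(x,y_2)+y_{[0]}\otimes(x\rightharpoonup y_{[1]})-y_{[0]}\otimes(y_{[1]}\leftharpoonup x)-yx_{[0]}\otimes x_{[1]}-y_1\otimes\sigma(y_2,x)-(y\triangleleft x_{\{1\}})\otimes x_{\{2\}}-x_1\otimes\sigma(y,x_2)-x_{[0]}\otimes(y\rightharpoonup x_{[1]})$; 3. $\Delta_A(x\rightharpoonup b)-\Delta_A(b\leftharpoonup x)+Q(x\triangleleft b)-Q(b\triangleright x)=x_{[-1]}\otimes(x_{[0]}\rightharpoonup b)+(x\rightharpoonup b_1)\otimes b_2+x_{\{1\}}\otimes[x_{\{2\}},b]+b_1\otimes(x\rightharpoonup b_2)-b_1\otimes(b_2\leftharpoonup x)-(b\leftharpoonup x_{[0]})\otimes x_{[1]}-bx_{\{1\}}\otimes x_{\{2\}}-x_{[-1]}\otimes(b\leftharpoonup x_{[0]})$; 4. $\Delta_V(a\triangleright y)-\Delta_V(y\triangleleft a)=(a\triangleright y_1)\otimes y_2+y_1\otimes(a\triangleright y_2)-y_1\otimes(y_2\triangleleft a)$; 5. $\Delta_A(\sigma(x,y)-\sigma(y,x))+Q([x,y])=x_{[-1]}\otimes\sigma(x_{[0]},y)+x_{\{1\}}\otimes(x_{\{2\}}\leftharpoonup y)+\sigma(x,y_{[0]})\otimes y_{[1]}+(x\rightharpoonup y_{\{1\}})\otimes y_{\{2\}}+y_{[-1]}\otimes\sigma(x,y_{[0]})+y_{\{1\}}\otimes(x\rightharpoonup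 y_{\{2\}})-y_{[-1]}\otimes\sigma(y_{[0]},x)-y_{\{1\}}\otimes(y_{\{2\}}\leftharpoonup x)-\sigma(y,x_{[0]})\otimes x_{[1]}-(y\rightharpoonup x_{\{1\}})\otimes x_{\{2\}}-x_{[-1]}\otimes\sigma(y,x_{[0]})-x_{\{1\}}\otimes(y\rightharpoonup x_{\{2\}})$; 6. $\gamma(x\triangleleft b)-\gamma(b\triangleright x)=x_1\otimes(x_2\rightharpoonup b)+x_{[0]}\otimes[x_{[1]},b]+(x\triangleleft b_1)\otimes b_2-(b\triangleright x_{[0]})\otimes x_{[1]}-x_1\otimes(b\leftharpoonup x_2)$; 7. $\rho(x\triangleleft b)-\rho(b\triangleright x)=x_{[-1]}\otimes(x_{[0]}\triangleleft b)+b_1\otimes(x\triangleleft b_2)-(b\leftharpoonup x_1)\otimes x_2-b_1\otimes(b_2\triangleright x)-bx_{[-1]}\otimes x_{[0]}-x_{[-1]}\otimes(b\triangleright x_{[0]})$; 8. $\rho(xy)-\tau\gamma(xy)=x_{[-1]}\otimes x_{[0]}y+(x\rightharpoonup y_{[-1]})\otimes y_{[0]}+x_{\{1\}}\otimes(x_{\{2\}}\triangleright y)+\sigma(x,y_1)\otimes y_2+y_{[-1]}\otimes xy_{[0]}+y_{\{1\}}\otimes(x\triangleleft y_{\{2\}})-\tau\big(x_{[0]}\otimes(x_{[1]}\leftharpoonup y)+xy_{[0]}\otimes y_{[1]}+x_1\otimes\sigma(x_2,y)+(x\triangleleft y_{\{1\}})\otimes y_{\{2\}}+y_1\otimes\sigma(x,y_2)+y_{[0]}\otimes(x\rightharpoonup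 y_{[1]})\big)$; 9. $(\mathrm{id}-\tau)(\Delta_A(x\rightharpoonup b)+Q(x\triangleleft b))=(\mathrm{id}-\tau)\big(x_{[-1]}\otimes(x_{[0]}\rightharpoonup b)+(x\rightharpoonup b_1)\otimes b_2+x_{\{1\}}\otimes x_{\{2\}}b+b_1\otimes(x\rightharpoonup b_2)\big)$; 10. $(\mathrm{id}-\tau)(\Delta_A(a\leftharpoonup y)+Q(a\triangleright y))=(\mathrm{id}-\tau)\big(a_1\otimes(a_2\leftharpoonup y)+(a\leftharpoonup y_{[0]})\otimes y_{[1]}+ay_{\{1\}}\otimes y_{\{2\}}+y_{[-1]}\otimes(a\leftharpoonup y_{[0]})+y_{\{1\}}\otimes ay_{\{2\}}\big)$; 11. $(\mathrm{id}-\tau)\Delta_V(a\triangleright y)=(\mathrm{id}-\tau)\big((a\triangleright y_1)\otimes y_2+y_1\otimes(a\triangleright y_2)\big)$; 12. $(\mathrm{id}-\tau)\Delta_V(x\triangleleft b)=x_1\otimes(x_2\triangleleft b)-(x_2\triangleleft b)\otimes x_1$; 13. $(\mathrm{id}-\tau)(\Delta_A(\sigma(x,y))+Q(xy))=(\mathrm{id}-\tau)\big(x_{[-1]}\otimes\sigma(x_{[0]},y)+x_{\{1\}}\otimes(x_{\{2\}}\leftharpoonup y)+\sigma(x,y_{[0]})\otimes y_{[1]}+(x\rightharpoonup y_{\{1\}})\otimes y_{\{2\}}+y_{[-1]}\otimes\sigma(x,y_{[0]})+y_{\{1\}}\otimes(x\rightharpoonup y_{\{2\}})\big)$; 14. $\gamma(x\triangleleft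 b)-\tau\rho(x\triangleleft b)=x_1\otimes(x_2\rightharpoonup b)+x_{[0]}\otimes x_{[1]}b+(x\triangleleft b_1)\otimes b_2-\tau\big(x_{[-1]}\otimes(x_{[0]}\triangleleft b)+b_1\otimes(x\triangleleft b_2)\big)$; 15. $\rho(a\triangleright y)-\tau\gamma(a\triangleright y)=(a\leftharpoonup y_1)\otimes y_2+a_1\otimes(a_2\triangleright y)+ay_{[-1]}\otimes y_{[0]}+y_{[-1]}\otimes(a\triangleright y_{[0]})-\tau\big((a\triangleright y_{[0]})\otimes y_{[1]}+y_1\otimes(a\leftharpoonup y_2)+y_{[0]}\otimes ay_{[1]}\big)$; 16. $\Delta_V([x,y])=x_1\otimes[x_2,y]+xy_1\otimes y_2-yx_1\otimes x_2-y_1\otimes[y_2,x]+x_{[0]}\otimes(x_{[1]}\triangleright y)+(x\triangleleft y_{[-1]})\otimes y_{[0]}+y_{[0]}\otimes(x\triangleleft y_{[1]})-y_{[0]}\otimes(y_{[1]}\triangleright x)-(y\triangleleft x_{[-1]})\otimes x_{[0]}-x_{[0]}\otimes(y\triangleleft x_{[1]})$; 17. $(\mathrm{id}-\tau)\Delta_V(xy)=(\mathrm{id}-\tau)\big(x_1\otimes x_2y+xy_1\otimes y_2+y_1\otimes xy_2+x_{[0]}\otimes(x_{[1]}\triangleright y)+(x\triangleleft y_{[-1]})\otimes y_{[0]}+y_{[0]}\otimes(x\triangleleft y_{[1]})\big)$. Conversely, any left-symmetric bialgebra structure on $E=A\oplus V$ for which the canonical injection $i:A\to E$, $a\mapsto(a,0)$,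 is both a left-symmetric algebra homomorphism and a left-symmetric coalgebra homomorphism is of this form.
   Context: All vector spaces are over a fixed field of characteristic zero. $\tau(u\otimes v)=v\otimes u$, $\tau_{12}(u\otimes v\otimes w)=v\otimes u\otimes w$, $[a,b]:=ab-ba$. A left-symmetric algebra has a bilinear product with $(ab)c-a(bc)=(ba)c-b(ac)$. A left-symmetric coalgebra has a linear coproduct $\Delta$ with $(\Delta\otimes\mathrm{id})\Delta(c)-(\mathrm{id}\otimes\Delta)\Delta(c)$ fixed by $\tau_{12}$. A left-symmetric bialgebra is both, with $\Delta([a,b])=ab_1\otimes b_2+b_1\otimes[a,b_2]-ba_1\otimes a_2-a_1\otimes[b,a_2]$ and $(\mathrm{id}-\tau)\Delta(ab)=(\mathrm{id}-\tau)(a_1\otimes a_2b+ab_1\otimes b_2+b_1\otimes ab_2)$. Summation-suppressed notation: $\Delta_A(a)=a_1\otimes a_2$, $\Delta_V(x)=x_1\otimes x_2$, $\rho(x)=x_{[-1]}\otimes x_{[0]}$, $\gamma(x)=x_{[0]}\otimes x_{[1]}$, $Q(x)=x_{\{1\}}\otimes x_{\{2\}}$; $[x,y]=xy-yx$ for $x,y\in V$. *)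

(* Defs.v *)
(* boolp is used only to quotient by the undecidable congruence tensor_eq. *)
From HB Require Import structures.
From mathcomp Require Import all_boot all_algebra.
From mathcomp Require Import boolp.

Set Implicit Arguments.
Unset Strict Implicit.
Unset Printing Implicit Defensive.

Import GRing.Theory.
Local Open Scope ring_scope.
Local Open Scope quotient_scope.

(* MathComp has no tensor product of arbitrary (possibly infinite-dimensional)
   vector spaces.  U ⊗ V is the free commutative monoid on pairs (u, v),
   encoded by finite sequences, modulo the congruence generated by
   biadditivity, balancedness, and 0 ⊗ v = 0; opposites and scalars act on the
   left factor.  Its universal property is tlift_linear, tliftE, tlift_uniq. *)
Inductive tensor_eq (K : fieldType) (U V : lmodType K) :
    seq (U * V) -> seq (U * V) -> Prop :=
| TensorRefl s : tensor_eq s s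
| TensorSym s t : tensor_eq s t -> tensor_eq t s
| TensorTrans s t r : tensor_eq s t -> tensor_eq t r -> tensor_eq s r
| TensorCat s s' t t' :
    tensor_eq s s' -> tensor_eq t t' -> tensor_eq (s ++ t) (s' ++ t')
| TensorCatC s t : tensor_eq (s ++ t) (t ++ s)
| TensorZero v : tensor_eq [:: (0, v)] [::]
| TensorDl u u' v : tensor_eq [:: (u + u', v)] [:: (u, v); (u', v)]
| TensorDr u v v' : tensor_eq [:: (u, v + v')] [:: (u, v); (u, v')]
| TensorZ a u v : tensor_eq [:: (a *: u, v)] [:: (u, a *: v)].

Section TensorType.
Variables (K : fieldType) (U V : lmodType K).

Definition tensor_rel : rel (seq (U * V)) := fun s t => `[< tensor_eq s t >].

Lemma tensor_rel_refl : reflexive tensor_rel.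
Proof. by move=> s; apply/asboolP; constructor. Qed.
Lemma tensor_rel_sym : symmetric tensor_rel.
Proof. by move=> s t; apply/asboolP/asboolP; apply: TensorSym. Qed.
Lemma tensor_rel_trans : transitive tensor_rel.
Proof.
move=> t s r /asboolP st /asboolP tr; apply/asboolP; exact: TensorTrans st tr.
Qed.

Canonical tensor_equiv :=
  EquivRel tensor_rel tensor_rel_refl tensor_rel_sym tensor_rel_trans.

Definition tensor : Type := {eq_quot tensor_rel}.
HB.instance Definition _ := Choice.on tensor.
HB.instance Definition _ : EqQuotient _ tensor_rel tensor :=
  EqQuotient.on tensor.

Definition tensor_pi (s : seq (U * V)) : tensor := \pi_tensor s.

Lemma tensor_reprK : cancel (fun t : tensor => repr t) tensor_pi.
Proof. by move=> t; rewrite /tensor_pi reprK. Qed.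

Lemma tensor_piP s t : tensor_pi s = tensor_pi t <-> tensor_eq s t.
Proof.
split; first by move/eqmodP/asboolP.
by move=> st; apply/eqmodP/asboolP.
Qed.

Lemma tensor_repr s : tensor_eq (repr (tensor_pi s)) s.
Proof. by apply/tensor_piP; rewrite tensor_reprK. Qed.

Definition tensor_smap (a : K) (s : seq (U * V)) :=
  [seq (a *: p.1, p.2) | p <- s].

Lemma tensor_eq_smap a s t :
  tensor_eq s t -> tensor_eq (tensor_smap a s) (tensor_smap a t).
Proof.
elim=> {s t} [s|s t _ IH|s t r _ IH1 _ IH2|s s' t t' _ IH1 _ IH2|s t|v
    |u u' v|u v v'|b u v] /=.
- exact: TensorRefl.
- exact: TensorSym.
- exact: TensorTrans IH1 IH2.
- by rewrite /tensor_smap !map_cat; apply: TensorCat.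
- by rewrite /tensor_smap !map_cat; apply: TensorCatC.
- by rewrite scaler0; apply: TensorZero.
- by rewrite scalerDr; apply: TensorDl.
- exact: TensorDr.
- by rewrite scalerA mulrC -scalerA; apply: TensorZ.
Qed.

Definition tensor_zero : tensor := tensor_pi [::].
Definition tensor_add (s t : tensor) : tensor := tensor_pi (repr s ++ repr t).
Definition tensor_scale (a : K) (t : tensor) : tensor :=
  tensor_pi (tensor_smap a (repr t)).
Definition tensor_opp (t : tensor) : tensor := tensor_scale (-1) t.

Lemma tensor_addE s t :
  tensor_add (tensor_pi s) (tensor_pi t) = tensor_pi (s ++ t).
Proof. by apply/tensor_piP/TensorCat; apply: tensor_repr. Qed.

Lemma tensor_scaleE a s :
  tensor_scale a (tensor_pi s) = tensor_pi (tensor_smap a s).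
Proof. by apply/tensor_piP/tensor_eq_smap/tensor_repr. Qed.

Lemma tensor_addA : associative tensor_add.
Proof.
move=> x y z; rewrite -[x]tensor_reprK -[y]tensor_reprK -[z]tensor_reprK.
by rewrite !tensor_addE catA.
Qed.

Lemma tensor_addC : commutative tensor_add.
Proof.
move=> x y; rewrite -[x]tensor_reprK -[y]tensor_reprK !tensor_addE.
by apply/tensor_piP/TensorCatC.
Qed.

Lemma tensor_add0 : left_id tensor_zero tensor_add.
Proof. by move=> x; rewrite -[x]tensor_reprK tensor_addE. Qed.

Lemma tensor_scale0 x : tensor_scale 0 x = tensor_zero.
Proof.
rewrite -[x]tensor_reprK tensor_scaleE; apply/tensor_piP.
elim: (repr x) => [|[u v] s IH] /=; first exact: TensorRefl.
rewrite scale0r -cat1s -[[::]]/([::] ++ [::]).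
by apply: TensorCat => //; apply: TensorZero.
Qed.

Lemma tensor_scaleDl x : {morph tensor_scale^~ x : a b / a + b >->
  tensor_add a b}.
Proof.
move=> a b; rewrite -[x]tensor_reprK !tensor_scaleE tensor_addE; apply/tensor_piP.
elim: (repr x) => [|[u v] s IH] /=; first exact: TensorRefl.
rewrite scalerDl -cat1s.
apply: (@TensorTrans _ _ _ _ ([:: (a *: u, v); (b *: u, v)] ++
  (tensor_smap a s ++ tensor_smap b s))).
  by apply: TensorCat => //; apply: TensorDl.
rewrite -[X in tensor_eq X _]/([:: (a *: u, v)] ++ (([:: (b *: u, v)] ++ tensor_smap a s)
  ++ tensor_smap b s)).
rewrite -[X in tensor_eq _ X]/([:: (a *: u, v)] ++ (tensor_smap a s ++
  ([:: (b *: u, v)] ++ tensor_smap b s))).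
apply: TensorCat; first exact: TensorRefl.
rewrite [X in tensor_eq _ X]catA.
by apply: TensorCat; [apply: TensorCatC | apply: TensorRefl].
Qed.

Lemma tensor_scale1 : left_id 1 tensor_scale.
Proof.
move=> x; rewrite -[x]tensor_reprK tensor_scaleE; congr (tensor_pi _).
by rewrite /tensor_smap -[RHS]map_id; apply: eq_map => -[u v]; rewrite /= scale1r.
Qed.

Lemma tensor_addN : left_inverse tensor_zero tensor_opp tensor_add.
Proof.
move=> x; rewrite /tensor_opp -{2}[x]tensor_scale1 -tensor_scaleDl addNr.
exact: tensor_scale0.
Qed.

HB.instance Definition _ :=
  GRing.isZmodule.Build tensor tensor_addA tensor_addC tensor_add0 tensor_addN.

Lemma tensor_scaleA a b x :
  tensor_scale a (tensor_scale b x) = tensor_scale (a * b) x.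
Proof.
rewrite -[x]tensor_reprK !tensor_scaleE; congr (tensor_pi _).
rewrite /tensor_smap -map_comp.
by apply: eq_map => -[u v]; rewrite /= scalerA.
Qed.

Lemma tensor_scaleDr : right_distributive tensor_scale +%R.
Proof.
move=> a x y; rewrite -[x]tensor_reprK -[y]tensor_reprK.
rewrite -[LHS]/(tensor_scale a (tensor_add _ _)).
rewrite -[RHS]/(tensor_add (tensor_scale a _) (tensor_scale a _)).
by rewrite tensor_addE !tensor_scaleE tensor_addE /tensor_smap map_cat.
Qed.

HB.instance Definition _ := GRing.Zmodule_isLmodule.Build K tensor
  tensor_scaleA tensor_scale1 tensor_scaleDr tensor_scaleDl.

Definition tpure (u : U) (v : V) : tensor := tensor_pi [:: (u, v)].

Lemma tensor_piD s t : tensor_pi (s ++ t) = tensor_pi s + tensor_pi t.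
Proof. by rewrite -tensor_addE. Qed.

Lemma tensor_pi_sum s : tensor_pi s = \sum_(p <- s) tpure p.1 p.2.
Proof.
elim: s => [|[u v] s IH]; first by rewrite big_nil.
by rewrite big_cons -IH -tensor_piD.
Qed.

Lemma tpure_bilinear : bilinear_for *:%R *:%R tpure.
Proof.
have Z a u v : tpure (a *: u) v = a *: tpure u v.
  by rewrite -[RHS]/(tensor_scale a _) tensor_scaleE.
split=> [v|u] a x y.
  rewrite /= -Z -tensor_piD; apply/tensor_piP; exact: TensorDl.
have Zr : tpure u (a *: x) = a *: tpure u x.
  by rewrite -Z; apply/tensor_piP/TensorSym/TensorZ.
by rewrite /= -Zr -tensor_piD; apply/tensor_piP; exact: TensorDr.
Qed.

HB.instance Definition _ :=
  bilinear_isBilinear.Build K U V tensor _ _ tpure tpure_bilinear.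

End TensorType.

Reserved Notation "u ⊗ v" (at level 40, left associativity).
Notation "U ⊗ V" := (tensor U%type V%type) : type_scope.
Notation "u ⊗ v" := (tpure u v) : ring_scope.

(* Sweedler notation: for t = \sum_i u_i ⊗ v_i, \tsum_(u , v <- t) F u v is
   \sum_i F u_i v_i.  It is independent of the decomposition as soon as F is
   bilinear, which is the only case in which it is used. *)
Definition tlift (K : fieldType) (U V W : lmodType K) (F : U -> V -> W)
  (t : U ⊗ V) : W := \sum_(p <- repr t) F p.1 p.2.

Notation "\tsum_ ( u , v <- t ) F" := (tlift (fun u v => F) t)
  (at level 41, F at level 41, t at level 200, u name, v name,
   format "'[' \tsum_ ( u ,  v  <-  t ) '/  '  F ']'") : ring_scope.

Section TensorLift.
Variables (K : fieldType) (U V W : lmodType K).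

Lemma tensor_ind_pure (P : U ⊗ V -> Prop) :
  P 0 -> (forall u v, P (u ⊗ v)) -> (forall s t, P s -> P t -> P (s + t)) ->
  forall t, P t.
Proof.
move=> P0 Pp PD t; rewrite -[t]tensor_reprK tensor_pi_sum.
by apply: big_ind => // p _; apply: Pp.
Qed.

Section Lift.
Variable F : U -> V -> W.
Hypothesis Fbil : bilinear_for *:%R *:%R F.

Let FDl u u' v : F (u + u') v = F u v + F u' v.
Proof. by have := Fbil.1 v 1 u u'; rewrite /= !scale1r. Qed.
Let FDr u v v' : F u (v + v') = F u v + F u v'.
Proof. by have := Fbil.2 u 1 v v'; rewrite /= !scale1r. Qed.
Let F0l v : F 0 v = 0.
Proof. by apply: (addrI (F 0 v)); rewrite -FDl !addr0. Qed.
Let F0r u : F u 0 = 0.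
Proof. by apply: (addrI (F u 0)); rewrite -FDr !addr0. Qed.
Let FZl a u v : F (a *: u) v = a *: F u v.
Proof. by have := Fbil.1 v a u 0; rewrite /= F0l !addr0. Qed.
Let FZr a u v : F u (a *: v) = a *: F u v.
Proof. by have := Fbil.2 u a v 0; rewrite /= F0r !addr0. Qed.

Lemma tlift_pi s : tlift F (tensor_pi s) = \sum_(p <- s) F p.1 p.2.
Proof.
suff E r t : tensor_eq r t ->
    \sum_(p <- r) F p.1 p.2 = \sum_(p <- t) F p.1 p.2 by exact/E/tensor_repr.
elim=> {r t} [//|r t _ -> //|r t t' _ -> _ -> //|r r' t t' _ IH1 _ IH2|r t|v
    |u u' v|u v v'|b u v].
- by rewrite !big_cat /= IH1 IH2.
- by rewrite !big_cat /= addrC.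
- by rewrite big_seq1 big_nil F0l.
- by rewrite big_seq1 big_cons big_seq1 FDl.
- by rewrite big_seq1 big_cons big_seq1 FDr.
- by rewrite !big_seq1 FZl FZr.
Qed.

Lemma tliftE u v : tlift F (u ⊗ v) = F u v.
Proof. by rewrite tlift_pi big_seq1. Qed.

Lemma tlift_linear : linear (tlift F).
Proof.
move=> a s t; rewrite -[s]tensor_reprK -[t]tensor_reprK.
rewrite -[X in X + _]/(tensor_scale a _) tensor_scaleE -tensor_piD.
rewrite !tlift_pi big_cat /= big_map scaler_sumr; congr (_ + _).
by apply: eq_bigr => -[u v] _; rewrite FZl.
Qed.

Lemma tlift_uniq (g : {linear (U ⊗ V)%type -> W}) :
  (forall u v, g (u ⊗ v) = F u v) -> g =1 tlift F.
Proof.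
move=> gE t; rewrite -[t in LHS]tensor_reprK tensor_pi_sum linear_sum.
by apply: eq_bigr => -[u v] _; rewrite gE.
Qed.

End Lift.
End TensorLift.

Section TensorMaps.
Variable K : fieldType.

Definition tmap (U V U' V' : lmodType K) (f : U -> U') (g : V -> V')
  (t : U ⊗ V) : U' ⊗ V' := \tsum_(u , v <- t) f u ⊗ g v.

Lemma tmap_linear (U V U' V' : lmodType K) (f : {linear U -> U'})
  (g : {linear V -> V'}) : linear (tmap f g).
Proof.
apply: tlift_linear; split=> [v|u] a x y.
  by rewrite linearP linearPl.
by rewrite linearP linearPr.
Qed.

HB.instance Definition _ (U V U' V' : lmodType K) (f : {linear U -> U'})
    (g : {linear V -> V'}) :=
  GRing.isLinear.Build K (U ⊗ V)%type (U' ⊗ V')%type _ (tmap f g) (tmap_linear f g).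

Definition tau (U V : lmodType K) (t : U ⊗ V) : V ⊗ U :=
  \tsum_(u , v <- t) v ⊗ u.

Lemma tau_linear (U V : lmodType K) : linear (@tau U V).
Proof.
apply: tlift_linear; split=> [v|u] a x y.
  by rewrite linearPr.
by rewrite linearPl.
Qed.

HB.instance Definition _ (U V : lmodType K) :=
  GRing.isLinear.Build K (U ⊗ V)%type (V ⊗ U)%type _ (@tau U V) (@tau_linear U V).

Definition id_sub_tau (U : lmodType K) (t : U ⊗ U) : U ⊗ U := t - tau t.

(* Triple tensor products are identified along u ⊗ (v ⊗ w) = (u ⊗ v) ⊗ w. *)
Definition tassoc (U V W : lmodType K) (t : U ⊗ (V ⊗ W)) : (U ⊗ V) ⊗ W :=
  \tsum_(u , p <- t) \tsum_(v , w <- p) (u ⊗ v) ⊗ w.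

Definition tau12 (U : lmodType K) : (U ⊗ U) ⊗ U -> (U ⊗ U) ⊗ U :=
  tmap (@tau U U) idfun.

End TensorMaps.

Section LeftSymmetric.
Variable K : fieldType.

Definition commutator (A : lmodType K) (m : A -> A -> A) (a b : A) : A :=
  m a b - m b a.

Definition ls_algebra (A : lmodType K) (m : {bilinear A -> A -> A}) : Prop :=
  forall a b c : A, m (m a b) c - m a (m b c) = m (m b a) c - m b (m a c).

Definition ls_coalgebra (C : lmodType K) (Delta : {linear C -> (C ⊗ C)%type}) : Prop :=
  forall c : C,
    let t := tmap Delta idfun (Delta c) - tassoc (tmap idfun Delta (Delta c)) in
    tau12 t = t.

Record ls_bialgebra (A : lmodType K) (m : {bilinear A -> A -> A})
    (Delta : {linear A -> (A ⊗ A)%type}) : Prop := LsBialgebra {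
  ls_bialgebra_alg : ls_algebra m;
  ls_bialgebra_coalg : ls_coalgebra Delta;
  ls_bialgebra_comm : forall a b : A,
    Delta (commutator m a b) =
        \tsum_(b1 , b2 <- Delta b) m a b1 ⊗ b2
      + \tsum_(b1 , b2 <- Delta b) b1 ⊗ commutator m a b2
      - \tsum_(a1 , a2 <- Delta a) m b a1 ⊗ a2
      - \tsum_(a1 , a2 <- Delta a) a1 ⊗ commutator m b a2;
  ls_bialgebra_mul : forall a b : A,
    id_sub_tau (Delta (m a b)) =
    id_sub_tau (\tsum_(a1 , a2 <- Delta a) a1 ⊗ m a2 b
              + \tsum_(b1 , b2 <- Delta b) m a b1 ⊗ b2
              + \tsum_(b1 , b2 <- Delta b) b1 ⊗ m a b2) }.

Definition ls_algebra_hom (A B : lmodType K) (mA : {bilinear A -> A -> A})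
    (mB : {bilinear B -> B -> B}) (f : {linear A -> B}) : Prop :=
  forall a b : A, f (mA a b) = mB (f a) (f b).

Definition ls_coalgebra_hom (A B : lmodType K) (DeltaA : {linear A -> (A ⊗ A)%type})
    (DeltaB : {linear B -> (B ⊗ B)%type}) (f : {linear A -> B}) : Prop :=
  forall a : A, DeltaB (f a) = tmap f f (DeltaA a).

End LeftSymmetric.

Section UnifiedProduct.
Variables (K : fieldType) (A V : lmodType K).

Record extending_datum := ExtendingDatum {
  ed_lactA : {linear (V ⊗ A)%type -> A};      (* ⇀ *)
  ed_ractA : {linear (A ⊗ V)%type -> A};      (* ↼ *)
  ed_ractV : {linear (V ⊗ A)%type -> V};      (* ◁ *)
  ed_lactV : {linear (A ⊗ V)%type -> V};      (* ▷ *)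
  ed_sigma : {linear (V ⊗ V)%type -> A};
  ed_mulV : {linear (V ⊗ V)%type -> V};
  ed_rho : {linear V -> (A ⊗ V)%type};
  ed_gamma : {linear V -> (V ⊗ A)%type};
  ed_Q : {linear V -> (A ⊗ A)%type};
  ed_DeltaV : {linear V -> (V ⊗ V)%type} }.

Definition injA (a : A) : A * V := (a, 0).
Definition injV (x : V) : A * V := (0, x).

Lemma injA_linear : linear injA.
Proof. by move=> k a b; congr pair; rewrite /= scaler0 addr0. Qed.
Lemma injV_linear : linear injV.
Proof. by move=> k a b; congr pair; rewrite /= scaler0 addr0. Qed.

HB.instance Definition _ :=
  GRing.isLinear.Build K A (A * V)%type _ injA injA_linear.
HB.instance Definition _ :=
  GRing.isLinear.Build K V (A * V)%type _ injV injV_linear.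

Variables (mulA : {bilinear A -> A -> A}) (DeltaA : {linear A -> (A ⊗ A)%type}).
Variable D : extending_datum.

Local Notation "a ∙ b" := (mulA a b) (at level 39, left associativity).
Local Notation "x ⇀ b" := (ed_lactA D (x ⊗ b)) (at level 39, no associativity).
Local Notation "a ↼ y" := (ed_ractA D (a ⊗ y)) (at level 39, no associativity).
Local Notation "x ◁ b" := (ed_ractV D (x ⊗ b)) (at level 39, no associativity).
Local Notation "a ▷ y" := (ed_lactV D (a ⊗ y)) (at level 39, no associativity).
Local Notation "x ∘ y" := (ed_mulV D (x ⊗ y)) (at level 39, left associativity).
Local Notation σ x y := (ed_sigma D (x ⊗ y)).
Local Notation ρ := (ed_rho D).
Local Notation γ := (ed_gamma D).
Local Notation Q := (ed_Q D).
Local Notation ΔA := DeltaA.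
Local Notation ΔV := (ed_DeltaV D).
Local Notation τ := (@tau K _ _).
Local Notation idτ := (@id_sub_tau K _).
Local Notation "[A a , b ]" := (commutator mulA a b)
  (at level 0, format "[A  a ,  b ]").
Local Notation "[V x , y ]" := (commutator (fun u v => u ∘ v) x y)
  (at level 0, format "[V  x ,  y ]").

Definition unified_mul (p q : A * V) : A * V :=
  let: (a, x) := p in let: (b, y) := q in
  (a ∙ b + x ⇀ b + a ↼ y + σ x y, x ∘ y + x ◁ b + a ▷ y).

Lemma unified_mul_bilinear : bilinear_for *:%R *:%R unified_mul.
Proof.
have sum4 (W : lmodType K) k (p1 p2 p3 p4 q1 q2 q3 q4 : W) :
    k *: p1 + q1 + (k *: p2 + q2) + (k *: p3 + q3) + (k *: p4 + q4) =
    k *: (p1 + p2 + p3 + p4) + (q1 + q2 + q3 + q4).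
  by rewrite !scalerDr [RHS]addrACA; congr (_ + _);
     rewrite [RHS]addrACA; congr (_ + _); rewrite addrACA.
have sum3 (W : lmodType K) k (p1 p2 p3 q1 q2 q3 : W) :
    k *: p1 + q1 + (k *: p2 + q2) + (k *: p3 + q3) =
    k *: (p1 + p2 + p3) + (q1 + q2 + q3).
  by rewrite !scalerDr [RHS]addrACA; congr (_ + _); rewrite addrACA.
split=> [[b y]|[a x]] k [c z] [c' z']; congr pair => /=.
- by rewrite !linearPl !linearP sum4.
- by rewrite !linearPl !linearP sum3.
- by rewrite !linearPr !linearP sum4.
- by rewrite !linearPr !linearP sum3.
Qed.

HB.instance Definition _ :=
  bilinear_isBilinear.Build K (A * V)%type (A * V)%type (A * V)%type _ _
    unified_mul unified_mul_bilinear.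

Definition unified_comul (p : A * V) : (A * V) ⊗ (A * V) :=
  let: (a, x) := p in
  tmap injA injA (ΔA a)
  + (tmap injV injV (ΔV x) + tmap injA injV (ρ x) + tmap injV injA (γ x)
     + tmap injA injA (Q x)).

Lemma unified_comul_linear : linear unified_comul.
Proof.
move=> k [a x] [b y]; rewrite /unified_comul /= !linearP !scalerDr.
rewrite [RHS]addrACA; congr (_ + _); rewrite [RHS]addrACA; congr (_ + _).
by rewrite [RHS]addrACA; congr (_ + _); rewrite addrACA.
Qed.

HB.instance Definition _ :=
  GRing.isLinear.Build K (A * V)%type ((A * V) ⊗ (A * V))%type _
    unified_comul unified_comul_linear.

Record unified_compat : Prop := UnifiedCompat {
  unified_compat1 : forall x y : V,
    ρ [V x, y] =
        \tsum_(xa , xv <- ρ x) xa ⊗ [V xv, y]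
      + \tsum_(ya , yv <- ρ y) (x ⇀ ya) ⊗ yv
      + \tsum_(p , q <- Q x) p ⊗ (q ▷ y)
      + \tsum_(y1 , y2 <- ΔV y) σ x y1 ⊗ y2
      + \tsum_(ya , yv <- ρ y) ya ⊗ [V x, yv]
      + \tsum_(p , q <- Q y) p ⊗ (x ◁ q)
      - \tsum_(xa , xv <- ρ x) (y ⇀ xa) ⊗ xv
      - \tsum_(p , q <- Q y) p ⊗ (q ▷ x)
      - \tsum_(x1 , x2 <- ΔV x) σ y x1 ⊗ x2
      - \tsum_(p , q <- Q x) p ⊗ (y ◁ q);
  unified_compat2 : forall x y : V,
    γ [V x, y] =
        \tsum_(xv , xa <- γ x) xv ⊗ (xa ↼ y)
      + \tsum_(yv , ya <- γ y) (x ∘ yv) ⊗ ya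
      + \tsum_(x1 , x2 <- ΔV x) x1 ⊗ σ x2 y
      + \tsum_(p , q <- Q y) (x ◁ p) ⊗ q
      + \tsum_(y1 , y2 <- ΔV y) y1 ⊗ σ x y2
      + \tsum_(yv , ya <- γ y) yv ⊗ (x ⇀ ya)
      - \tsum_(yv , ya <- γ y) yv ⊗ (ya ↼ x)
      - \tsum_(xv , xa <- γ x) (y ∘ xv) ⊗ xa
      - \tsum_(y1 , y2 <- ΔV y) y1 ⊗ σ y2 x
      - \tsum_(p , q <- Q x) (y ◁ p) ⊗ q
      - \tsum_(x1 , x2 <- ΔV x) x1 ⊗ σ y x2
      - \tsum_(xv , xa <- γ x) xv ⊗ (y ⇀ xa);
  unified_compat3 : forall (x : V) (b : A),
    ΔA (x ⇀ b) - ΔA (b ↼ x) + Q (x ◁ b) - Q (b ▷ x) =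
        \tsum_(xa , xv <- ρ x) xa ⊗ (xv ⇀ b)
      + \tsum_(b1 , b2 <- ΔA b) (x ⇀ b1) ⊗ b2
      + \tsum_(p , q <- Q x) p ⊗ [A q, b]
      + \tsum_(b1 , b2 <- ΔA b) b1 ⊗ (x ⇀ b2)
      - \tsum_(b1 , b2 <- ΔA b) b1 ⊗ (b2 ↼ x)
      - \tsum_(xv , xa <- γ x) (b ↼ xv) ⊗ xa
      - \tsum_(p , q <- Q x) (b ∙ p) ⊗ q
      - \tsum_(xa , xv <- ρ x) xa ⊗ (b ↼ xv);
  unified_compat4 : forall (a : A) (y : V),
    ΔV (a ▷ y) - ΔV (y ◁ a) =
        \tsum_(y1 , y2 <- ΔV y) (a ▷ y1) ⊗ y2
      + \tsum_(y1 , y2 <- ΔV y) y1 ⊗ (a ▷ y2)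
      - \tsum_(y1 , y2 <- ΔV y) y1 ⊗ (y2 ◁ a);
  unified_compat5 : forall x y : V,
    ΔA (σ x y - σ y x) + Q [V x, y] =
        \tsum_(xa , xv <- ρ x) xa ⊗ σ xv y
      + \tsum_(p , q <- Q x) p ⊗ (q ↼ y)
      + \tsum_(yv , ya <- γ y) σ x yv ⊗ ya
      + \tsum_(p , q <- Q y) (x ⇀ p) ⊗ q
      + \tsum_(ya , yv <- ρ y) ya ⊗ σ x yv
      + \tsum_(p , q <- Q y) p ⊗ (x ⇀ q)
      - \tsum_(ya , yv <- ρ y) ya ⊗ σ yv x
      - \tsum_(p , q <- Q y) p ⊗ (q ↼ x)
      - \tsum_(xv , xa <- γ x) σ y xv ⊗ xa
      - \tsum_(p , q <- Q x) (y ⇀ p) ⊗ q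
      - \tsum_(xa , xv <- ρ x) xa ⊗ σ y xv
      - \tsum_(p , q <- Q x) p ⊗ (y ⇀ q);
  unified_compat6 : forall (x : V) (b : A),
    γ (x ◁ b) - γ (b ▷ x) =
        \tsum_(x1 , x2 <- ΔV x) x1 ⊗ (x2 ⇀ b)
      + \tsum_(xv , xa <- γ x) xv ⊗ [A xa, b]
      + \tsum_(b1 , b2 <- ΔA b) (x ◁ b1) ⊗ b2
      - \tsum_(xv , xa <- γ x) (b ▷ xv) ⊗ xa
      - \tsum_(x1 , x2 <- ΔV x) x1 ⊗ (b ↼ x2);
  unified_compat7 : forall (x : V) (b : A),
    ρ (x ◁ b) - ρ (b ▷ x) =
        \tsum_(xa , xv <- ρ x) xa ⊗ (xv ◁ b)
      + \tsum_(b1 , b2 <- ΔA b) b1 ⊗ (x ◁ b2)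
      - \tsum_(x1 , x2 <- ΔV x) (b ↼ x1) ⊗ x2
      - \tsum_(b1 , b2 <- ΔA b) b1 ⊗ (b2 ▷ x)
      - \tsum_(xa , xv <- ρ x) (b ∙ xa) ⊗ xv
      - \tsum_(xa , xv <- ρ x) xa ⊗ (b ▷ xv);
  unified_compat8 : forall x y : V,
    ρ (x ∘ y) - τ (γ (x ∘ y)) =
        \tsum_(xa , xv <- ρ x) xa ⊗ (xv ∘ y)
      + \tsum_(ya , yv <- ρ y) (x ⇀ ya) ⊗ yv
      + \tsum_(p , q <- Q x) p ⊗ (q ▷ y)
      + \tsum_(y1 , y2 <- ΔV y) σ x y1 ⊗ y2
      + \tsum_(ya , yv <- ρ y) ya ⊗ (x ∘ yv)
      + \tsum_(p , q <- Q y) p ⊗ (x ◁ q)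
      - τ (\tsum_(xv , xa <- γ x) xv ⊗ (xa ↼ y)
         + \tsum_(yv , ya <- γ y) (x ∘ yv) ⊗ ya
         + \tsum_(x1 , x2 <- ΔV x) x1 ⊗ σ x2 y
         + \tsum_(p , q <- Q y) (x ◁ p) ⊗ q
         + \tsum_(y1 , y2 <- ΔV y) y1 ⊗ σ x y2
         + \tsum_(yv , ya <- γ y) yv ⊗ (x ⇀ ya));
  unified_compat9 : forall (x : V) (b : A),
    idτ (ΔA (x ⇀ b) + Q (x ◁ b)) =
    idτ (\tsum_(xa , xv <- ρ x) xa ⊗ (xv ⇀ b)
       + \tsum_(b1 , b2 <- ΔA b) (x ⇀ b1) ⊗ b2
       + \tsum_(p , q <- Q x) p ⊗ (q ∙ b)
       + \tsum_(b1 , b2 <- ΔA b) b1 ⊗ (x ⇀ b2));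
  unified_compat10 : forall (a : A) (y : V),
    idτ (ΔA (a ↼ y) + Q (a ▷ y)) =
    idτ (\tsum_(a1 , a2 <- ΔA a) a1 ⊗ (a2 ↼ y)
       + \tsum_(yv , ya <- γ y) (a ↼ yv) ⊗ ya
       + \tsum_(p , q <- Q y) (a ∙ p) ⊗ q
       + \tsum_(ya , yv <- ρ y) ya ⊗ (a ↼ yv)
       + \tsum_(p , q <- Q y) p ⊗ (a ∙ q));
  unified_compat11 : forall (a : A) (y : V),
    idτ (ΔV (a ▷ y)) =
    idτ (\tsum_(y1 , y2 <- ΔV y) (a ▷ y1) ⊗ y2
       + \tsum_(y1 , y2 <- ΔV y) y1 ⊗ (a ▷ y2));
  unified_compat12 : forall (x : V) (b : A),
    idτ (ΔV (x ◁ b)) =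
        \tsum_(x1 , x2 <- ΔV x) x1 ⊗ (x2 ◁ b)
      - \tsum_(x1 , x2 <- ΔV x) (x2 ◁ b) ⊗ x1;
  unified_compat13 : forall x y : V,
    idτ (ΔA (σ x y) + Q (x ∘ y)) =
    idτ (\tsum_(xa , xv <- ρ x) xa ⊗ σ xv y
       + \tsum_(p , q <- Q x) p ⊗ (q ↼ y)
       + \tsum_(yv , ya <- γ y) σ x yv ⊗ ya
       + \tsum_(p , q <- Q y) (x ⇀ p) ⊗ q
       + \tsum_(ya , yv <- ρ y) ya ⊗ σ x yv
       + \tsum_(p , q <- Q y) p ⊗ (x ⇀ q));
  unified_compat14 : forall (x : V) (b : A),
    γ (x ◁ b) - τ (ρ (x ◁ b)) =
        \tsum_(x1 , x2 <- ΔV x) x1 ⊗ (x2 ⇀ b)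
      + \tsum_(xv , xa <- γ x) xv ⊗ (xa ∙ b)
      + \tsum_(b1 , b2 <- ΔA b) (x ◁ b1) ⊗ b2
      - τ (\tsum_(xa , xv <- ρ x) xa ⊗ (xv ◁ b)
         + \tsum_(b1 , b2 <- ΔA b) b1 ⊗ (x ◁ b2));
  unified_compat15 : forall (a : A) (y : V),
    ρ (a ▷ y) - τ (γ (a ▷ y)) =
        \tsum_(y1 , y2 <- ΔV y) (a ↼ y1) ⊗ y2
      + \tsum_(a1 , a2 <- ΔA a) a1 ⊗ (a2 ▷ y)
      + \tsum_(ya , yv <- ρ y) (a ∙ ya) ⊗ yv
      + \tsum_(ya , yv <- ρ y) ya ⊗ (a ▷ yv)
      - τ (\tsum_(yv , ya <- γ y) (a ▷ yv) ⊗ ya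
         + \tsum_(y1 , y2 <- ΔV y) y1 ⊗ (a ↼ y2)
         + \tsum_(yv , ya <- γ y) yv ⊗ (a ∙ ya));
  unified_compat16 : forall x y : V,
    ΔV [V x, y] =
        \tsum_(x1 , x2 <- ΔV x) x1 ⊗ [V x2, y]
      + \tsum_(y1 , y2 <- ΔV y) (x ∘ y1) ⊗ y2
      - \tsum_(x1 , x2 <- ΔV x) (y ∘ x1) ⊗ x2
      - \tsum_(y1 , y2 <- ΔV y) y1 ⊗ [V y2, x]
      + \tsum_(xv , xa <- γ x) xv ⊗ (xa ▷ y)
      + \tsum_(ya , yv <- ρ y) (x ◁ ya) ⊗ yv
      + \tsum_(yv , ya <- γ y) yv ⊗ (x ◁ ya)
      - \tsum_(yv , ya <- γ y) yv ⊗ (ya ▷ x)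
      - \tsum_(xa , xv <- ρ x) (y ◁ xa) ⊗ xv
      - \tsum_(xv , xa <- γ x) xv ⊗ (y ◁ xa);
  unified_compat17 : forall x y : V,
    idτ (ΔV (x ∘ y)) =
    idτ (\tsum_(x1 , x2 <- ΔV x) x1 ⊗ (x2 ∘ y)
       + \tsum_(y1 , y2 <- ΔV y) (x ∘ y1) ⊗ y2
       + \tsum_(y1 , y2 <- ΔV y) y1 ⊗ (x ∘ y2)
       + \tsum_(xv , xa <- γ x) xv ⊗ (xa ▷ y)
       + \tsum_(ya , yv <- ρ y) (x ◁ ya) ⊗ yv
       + \tsum_(yv , ya <- γ y) yv ⊗ (x ◁ ya)) }.


End UnifiedProduct.

(* Main.v *)
Require Import Defs.
From HB Require Import structures.
From mathcomp Require Import all_boot all_algebra.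
From mathcomp Require Import boolp.
Import GRing.Theory.

Set Implicit Arguments.
Unset Strict Implicit.
Unset Printing Implicit Defensive.

Local Open Scope ring_scope.

(** For a product m and a coproduct Delta on E, each of the two compatibility
    axioms of a bialgebra says that a certain map E x E -> E ⊗ E vanishes: call
    these maps the commutator defect and the multiplication defect.  Both are
    biadditive.  On E = A ⊕ V they therefore vanish as soon as they vanish on
    pairs of arguments taken from A or V.  On A x A nothing has to be checked:
    the inclusion of A respects both structures, so it carries the defects of A,
    which are zero, to those of E ([defects_hom]).  The commutator defect is
    antisymmetric in its two arguments, so A x V reduces to V x A.  This leaves
    V x A and V x V for the commutator defect, and V x A, A x V and V x V for
    the multiplication defect.

    Each remaining value lies in E ⊗ E, which is the direct sum of A ⊗ A, A ⊗ V,
    V ⊗ A and V ⊗ V ([tensor_blocks]); it is zero if and only if its four blocks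
    are.  The multiplication defect has the form t - tau t, so its block in
    A ⊗ V determines the one in V ⊗ A and only three blocks count.  That makes
    2 * 4 + 3 * 3 = 17 equations.  Expanding a block of the coproduct of E and a
    component of the product of E shows that these equations are exactly the
    seventeen compatibility conditions ([unified_compat_defects]), whence the
    equivalence ([unified_bialgebraP]).

    For the converse, given a bialgebra structure on A ⊕ V extending that of A,
    take as extending datum the components of the product on V x A, A x V, V x V
    and the blocks of the coproduct on V ([restricted_datum]).  The unified
    product and coproduct of this datum give back the structure, and the
    equivalence applies. *)

(** * Identities in abelian groups *)

Inductive zexpr := ZVar of nat | ZZero | ZAdd of zexpr & zexpr | ZOpp of zexpr.

Fixpoint zeval (M : zmodType) (env : seq M) (e : zexpr) : M :=
  match e with
  | ZVar k => env`_k
  | ZZero => 0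
  | ZAdd e1 e2 => zeval env e1 + zeval env e2
  | ZOpp e1 => - zeval env e1
  end.

Fixpoint zcoef (e : zexpr) (i : nat) : int :=
  match e with
  | ZVar k => (i == k)%:Z
  | ZZero => 0
  | ZAdd e1 e2 => zcoef e1 i + zcoef e2 i
  | ZOpp e1 => - zcoef e1 i
  end.

Lemma zeval_coef (M : zmodType) (env : seq M) (e : zexpr) :
  zeval env e = \sum_(i < size env) env`_i *~ zcoef e i.
Proof.
elim: e => [k||e1 IH1 e2 IH2|e IH] /=.
- have [lt_k|le_k] := ltnP k (size env).
    rewrite (bigD1 (Ordinal lt_k)) //= eqxx mulr1z big1 ?addr0 // => i neq_i.
    by have /negPf -> : val i != k by [].
  rewrite nth_default // big1 // => i _.
  by rewrite ltn_eqF ?mulr0z // (leq_trans (ltn_ord i)).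
- by rewrite big1 // => i _; rewrite mulr0z.
- by rewrite IH1 IH2 -big_split; apply: eq_bigr => i _; rewrite mulrzDr.
- by rewrite IH -sumrN; apply: eq_bigr => i _; rewrite mulrNz.
Qed.

(** Once the atoms are listed in [env], an identity between signed sums reduces
    to comparing integer coefficients, which is a computation. *)
Lemma zeval_eq (M : zmodType) (env : seq M) (e1 e2 : zexpr) :
  all (fun i => zcoef e1 i == zcoef e2 i) (iota 0 (size env)) ->
  zeval env e1 = zeval env e2.
Proof.
move=> /allP eq_coef; rewrite !zeval_coef; apply: eq_bigr => i _.
by rewrite (eqP (eq_coef _ _)) // mem_iota add0n ltn_ord.
Qed.

(* Atoms are compared up to conversion: the same tensor may carry two
   presentations of one linear structure, or be written with tmap or tlift. *)
Ltac zindex t env :=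
  lazymatch env with
  | cons ?x ?env' =>
      match constr:(Set) with
      | _ => let _ := match constr:(Set) with _ => unify t x end in constr:(O)
      | _ => let k := zindex t env' in constr:(S k)
      end
  end.
Ltac zatoms env t :=
  lazymatch t with
  | (?x + ?y)%R => let env1 := zatoms env x in zatoms env1 y
  | (- ?x)%R => zatoms env x
  | 0%R => env
  | _ =>
      match constr:(Set) with
      | _ => let _ := zindex t env in env
      | _ => constr:(cons t env)
      end
  end.
Ltac zreify env t :=
  lazymatch t with
  | (?x + ?y)%R =>
      let e1 := zreify env x in let e2 := zreify env y in constr:(ZAdd e1 e2)
  | (- ?x)%R => let e1 := zreify env x in constr:(ZOpp e1)
  | 0%R => constr:(ZZero)
  | _ => let k := zindex t env in constr:(ZVar k)
  end.
Ltac zmod :=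
  lazymatch goal with
  | |- @eq ?M ?x ?y =>
      let env0 := zatoms (@nil M) x in
      let env := zatoms env0 y in
      let e1 := zreify env x in
      let e2 := zreify env y in
      exact: (@zeval_eq _ env e1 e2 isT)
  end.

(** Passes from one equation to another, in either direction, when the
    differences of their sides agree, which [zmod] can decide. *)
Lemma eq_of_subr (M : zmodType) (x y z t : M) : x - y = z - t -> x = y -> z = t.
Proof. by move=> E xy; apply/eqP; rewrite -subr_eq0 -E xy subrr. Qed.

(** * Tensor products of maps *)

Section TensorMaps.
Variable K : fieldType.
Implicit Types U V W : lmodType K.

Lemma tmap_pure U V U' V' (f : {linear U -> U'}) (g : {linear V -> V'}) u v :
  tmap f g (u ⊗ v) = f u ⊗ g v.
Proof.
rewrite /tmap tliftE //; split=> [w|w] a x y.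
  by rewrite linearP linearPl.
by rewrite linearP linearPr.
Qed.

Lemma tmap_comp U V U' V' U'' V'' (f : {linear U' -> U''})
    (g : {linear V' -> V''}) (f' : U -> U') (g' : V -> V') t :
  tmap f g (tmap f' g' t) = tmap (f \o f') (g \o g') t.
Proof.
rewrite -[tmap f' g' t]/(\sum_(p <- repr t) f' p.1 ⊗ g' p.2) linear_sum.
by apply: eq_bigr => p _; apply: tmap_pure.
Qed.

Lemma tmapD U V U' V' (f : {linear U -> U'}) (g : {linear V -> V'}) s t :
  tmap f g (s + t) = tmap f g s + tmap f g t.
Proof. exact: linearD. Qed.

Lemma tmapN U V U' V' (f : {linear U -> U'}) (g : {linear V -> V'}) t :
  tmap f g (- t) = - tmap f g t.
Proof. exact: linearN. Qed.

Lemma tmap0 U V U' V' (f : {linear U -> U'}) (g : {linear V -> V'}) :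
  tmap f g 0 = 0.
Proof. exact: linear0. Qed.

Lemma tau0 U V : tau (0 : (U ⊗ V)%type) = 0.
Proof. exact: linear0. Qed.

Lemma tauD U V (s t : (U ⊗ V)%type) : tau (s + t) = tau s + tau t.
Proof. exact: linearD. Qed.

Lemma tauN U V (t : (U ⊗ V)%type) : tau (- t) = - tau t.
Proof. exact: linearN. Qed.

Lemma tau_pure U V (u : U) (v : V) : tau (u ⊗ v) = v ⊗ u.
Proof.
rewrite /tau tliftE //; split=> [w|w] a x y.
  by rewrite linearPr.
by rewrite linearPl.
Qed.

Lemma tau_tmap U V U' V' (f : U -> U') (g : V -> V') t :
  tau (\tsum_(u , v <- t) f u ⊗ g v) = \tsum_(u , v <- t) g v ⊗ f u.
Proof.
by rewrite /tlift linear_sum; apply: eq_bigr => p _; apply: tau_pure.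
Qed.

Lemma tauK U V (t : (U ⊗ V)%type) : tau (tau t) = t.
Proof.
elim/tensor_ind_pure: t => [|u v|s t IHs IHt]; first by rewrite !linear0.
  by rewrite !tau_pure.
by rewrite !linearD /= IHs IHt.
Qed.

Lemma tmap_tau U V U' V' (f : {linear U -> U'}) (g : {linear V -> V'})
    (t : (V ⊗ U)%type) :
  tmap f g (tau t) = tau (tmap g f t).
Proof.
elim/tensor_ind_pure: t => [|u v|s t IHs IHt]; first by rewrite !linear0.
  by rewrite tmap_pure !tau_pure tmap_pure.
by rewrite !linearD /= IHs IHt.
Qed.

Lemma id_sub_tauD U (s t : (U ⊗ U)%type) :
  id_sub_tau (s + t) = id_sub_tau s + id_sub_tau t.
Proof. by rewrite /id_sub_tau linearD opprD addrACA. Qed.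

Lemma tau_id_sub_tau U (t : (U ⊗ U)%type) :
  tau (id_sub_tau t) = - id_sub_tau t.
Proof. by rewrite /id_sub_tau linearB opprB /= tauK. Qed.

Lemma tmap_idfun U V (t : (U ⊗ V)%type) : tmap idfun idfun t = t.
Proof.
elim/tensor_ind_pure: t => [|u v|s t IHs IHt]; first by rewrite linear0.
  by rewrite tmap_pure.
by rewrite linearD /= IHs IHt.
Qed.

Lemma tmap0l U V U' V' (g : V -> V') (t : (U ⊗ V)%type) :
  tmap (fun=> 0 : U') g t = 0.
Proof. by rewrite /tmap /tlift big1 // => p _; rewrite linear0l. Qed.

Lemma tmap0r U V U' V' (f : U -> U') (t : (U ⊗ V)%type) :
  tmap f (fun=> 0 : V') t = 0.
Proof. by rewrite /tmap /tlift big1 // => p _; rewrite linear0r. Qed.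

Lemma tmapDl U V U' V' (f1 f2 : U -> U') (g : V -> V') t :
  tmap (fun u => f1 u + f2 u) g t = tmap f1 g t + tmap f2 g t.
Proof.
by rewrite /tmap /tlift -big_split; apply: eq_bigr => p _; rewrite linearDl.
Qed.

Lemma tmapDr U V U' V' (f : U -> U') (g1 g2 : V -> V') t :
  tmap f (fun v => g1 v + g2 v) t = tmap f g1 t + tmap f g2 t.
Proof.
by rewrite /tmap /tlift -big_split; apply: eq_bigr => p _; rewrite linearDr.
Qed.

Lemma tmapBr U V U' V' (f : U -> U') (g1 g2 : V -> V') t :
  \tsum_(u , v <- t) f u ⊗ (g1 v - g2 v) =
  \tsum_(u , v <- t) f u ⊗ g1 v - \tsum_(u , v <- t) f u ⊗ g2 v.
Proof. by rewrite /tlift -sumrB; apply: eq_bigr => p _; rewrite linearBr. Qed.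

End TensorMaps.

(** * Bialgebra axioms as vanishing defects *)

Section Defects.
Variables (K : fieldType) (E : lmodType K) (m : {bilinear E -> E -> E}).

(** Partial applications of the product under names of their own, so that they
    carry a linear structure that [tmap] can use. *)
Definition lmul (p q : E) : E := m p q.
Definition rmul (p q : E) : E := m q p.

Lemma lmul_linear p : linear (lmul p).
Proof. by move=> k q r; rewrite /lmul linearPr. Qed.
Lemma rmul_linear p : linear (rmul p).
Proof. by move=> k q r; rewrite /rmul linearPl. Qed.

HB.instance Definition _ p :=
  GRing.isLinear.Build K E E _ (lmul p) (lmul_linear p).
HB.instance Definition _ p :=
  GRing.isLinear.Build K E E _ (rmul p) (rmul_linear p).

Lemma lmulD p p' : lmul (p + p') = fun q => lmul p q + lmul p' q.
Proof. by apply: funext => q; rewrite /lmul linearDl. Qed.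
Lemma rmulD p p' : rmul (p + p') = fun q => rmul p q + rmul p' q.
Proof. by apply: funext => q; rewrite /rmul linearDr. Qed.

Variable Delta : {linear E -> (E ⊗ E)%type}.

(** The terms of the commutator axiom split into two families exchanged by the
    two arguments: [comm_half p q] collects those with Delta q and p * q. *)
Definition comm_half (p q : E) : E ⊗ E :=
  Delta (m p q) - tmap (lmul p) idfun (Delta q) - tmap idfun (lmul p) (Delta q)
  + tmap idfun (rmul p) (Delta q).

Definition comm_defect (p q : E) : E ⊗ E := comm_half p q - comm_half q p.

Definition mul_half (p q : E) : E ⊗ E :=
  Delta (m p q) - tmap idfun (rmul q) (Delta p)
  - tmap (lmul p) idfun (Delta q) - tmap idfun (lmul p) (Delta q).

Definition mul_defect (p q : E) : E ⊗ E := id_sub_tau (mul_half p q).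

Lemma ls_bialgebraE :
  ls_bialgebra m Delta <->
  [/\ ls_algebra m, ls_coalgebra Delta,
      forall p q, comm_defect p q = 0 & forall p q, mul_defect p q = 0].
Proof.
have Cexp p t : \tsum_(u , v <- t) u ⊗ commutator m p v =
    tmap idfun (lmul p) t - tmap idfun (rmul p) t.
  by rewrite /commutator tmapBr.
have comm p q : Delta (commutator m p q) -
    (\tsum_(u , v <- Delta q) m p u ⊗ v
      + \tsum_(u , v <- Delta q) u ⊗ commutator m p v
      - \tsum_(u , v <- Delta p) m q u ⊗ v
      - \tsum_(u , v <- Delta p) u ⊗ commutator m q v) = comm_defect p q - 0.
  rewrite !Cexp /commutator linearB /comm_defect /comm_half /=.
  by rewrite -/(tmap (lmul p) idfun _) -/(tmap (lmul q) idfun _); zmod.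
have mul p q : id_sub_tau (Delta (m p q)) -
    id_sub_tau (\tsum_(u , v <- Delta p) u ⊗ m v q
              + \tsum_(u , v <- Delta q) m p u ⊗ v
              + \tsum_(u , v <- Delta q) u ⊗ m p v) = mul_defect p q - 0.
  rewrite /mul_defect /mul_half /id_sub_tau !(linearB, linearD) /=.
  rewrite -/(tmap (lmul p) idfun _) -/(tmap idfun (lmul p) _).
  by rewrite -/(tmap idfun (rmul q) _); zmod.
split=> [[alg coalg C M]|[alg coalg C M]]; split=> // p q.
- exact: eq_of_subr (comm p q) (C p q).
- exact: eq_of_subr (mul p q) (M p q).
- exact: eq_of_subr (esym (comm p q)) (C p q).
- exact: eq_of_subr (esym (mul p q)) (M p q).
Qed.

Lemma comm_halfDl p p' q : comm_half (p + p') q = comm_half p q + comm_half p' q.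
Proof.
by rewrite /comm_half lmulD rmulD !(tmapDl, tmapDr) linearDl linearD /=; zmod.
Qed.
Lemma comm_halfDr p q q' : comm_half p (q + q') = comm_half p q + comm_half p q'.
Proof. by rewrite /comm_half linearDr !linearD /=; zmod. Qed.

Lemma tmap_comm_half (W W' : lmodType K) (f : {linear E -> W})
    (g : {linear E -> W'}) p q :
  tmap f g (comm_half p q) =
    tmap f g (Delta (m p q)) - tmap (f \o lmul p) g (Delta q)
    - tmap f (g \o lmul p) (Delta q) + tmap f (g \o rmul p) (Delta q).
Proof. by rewrite /comm_half !(tmapD, tmapN, tmap_comp). Qed.

Lemma tmap_comm_defect (W W' : lmodType K) (f : {linear E -> W})
    (g : {linear E -> W'}) p q :
  tmap f g (comm_defect p q) =
    tmap f g (comm_half p q) - tmap f g (comm_half q p).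
Proof. by rewrite /comm_defect tmapD tmapN. Qed.

Lemma comm_defectDl p p' q :
  comm_defect (p + p') q = comm_defect p q + comm_defect p' q.
Proof. by rewrite /comm_defect comm_halfDl comm_halfDr; zmod. Qed.

Lemma comm_defectDr p q q' :
  comm_defect p (q + q') = comm_defect p q + comm_defect p q'.
Proof. by rewrite /comm_defect comm_halfDl comm_halfDr; zmod. Qed.

Lemma comm_defectC p q : comm_defect q p = - comm_defect p q.
Proof. by rewrite /comm_defect opprB. Qed.

Lemma mul_halfDl p p' q : mul_half (p + p') q = mul_half p q + mul_half p' q.
Proof.
by rewrite /mul_half lmulD !(tmapDl, tmapDr) linearDl !linearD /=; zmod.
Qed.
Lemma mul_halfDr p q q' : mul_half p (q + q') = mul_half p q + mul_half p q'.
Proof. by rewrite /mul_half rmulD tmapDr linearDr !linearD /=; zmod. Qed.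

Lemma tmap_mul_half (W W' : lmodType K) (f : {linear E -> W})
    (g : {linear E -> W'}) p q :
  tmap f g (mul_half p q) =
    tmap f g (Delta (m p q)) - tmap f (g \o rmul q) (Delta p)
    - tmap (f \o lmul p) g (Delta q) - tmap f (g \o lmul p) (Delta q).
Proof. by rewrite /mul_half !(tmapD, tmapN, tmap_comp). Qed.

Lemma tmap_mul_defect (W W' : lmodType K) (f : {linear E -> W})
    (g : {linear E -> W'}) p q :
  tmap f g (mul_defect p q) =
    tmap f g (mul_half p q) - tau (tmap g f (mul_half p q)).
Proof. by rewrite /mul_defect /id_sub_tau tmapD tmapN tmap_tau. Qed.

Lemma mul_defectDl p p' q :
  mul_defect (p + p') q = mul_defect p q + mul_defect p' q.
Proof. by rewrite /mul_defect mul_halfDl id_sub_tauD. Qed.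
Lemma mul_defectDr p q q' :
  mul_defect p (q + q') = mul_defect p q + mul_defect p q'.
Proof. by rewrite /mul_defect mul_halfDr id_sub_tauD. Qed.

Lemma tau_mul_defect p q : tau (mul_defect p q) = - mul_defect p q.
Proof. exact: tau_id_sub_tau. Qed.

End Defects.

(** The defects are built from the product and the coproduct alone, so they are
    natural under maps that respect both. *)
Lemma defects_hom (K : fieldType) (A E : lmodType K)
    (mA : {bilinear A -> A -> A}) (DeltaA : {linear A -> (A ⊗ A)%type})
    (m : {bilinear E -> E -> E}) (Delta : {linear E -> (E ⊗ E)%type})
    (f : {linear A -> E}) :
  ls_algebra_hom mA m f -> ls_coalgebra_hom DeltaA Delta f -> forall a b,
  comm_defect m Delta (f a) (f b) = tmap f f (comm_defect mA DeltaA a b) /\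
  mul_defect m Delta (f a) (f b) = tmap f f (mul_defect mA DeltaA a b).
Proof.
move=> fM fD.
have fl c : lmul m (f c) \o f = f \o lmul mA c.
  by apply: funext => d; rewrite /= /lmul fM.
have fr c : rmul m (f c) \o f = f \o rmul mA c.
  by apply: funext => d; rewrite /= /rmul fM.
have commf c d :
    comm_half m Delta (f c) (f d) = tmap f f (comm_half mA DeltaA c d).
  by rewrite tmap_comm_half /comm_half -fM !fD !tmap_comp !fl !fr.
have mulf c d :
    mul_half m Delta (f c) (f d) = tmap f f (mul_half mA DeltaA c d).
  by rewrite tmap_mul_half /mul_half -fM !fD !tmap_comp !fl !fr.
move=> a b; split; first by rewrite tmap_comm_defect /comm_defect !commf.
by rewrite tmap_mul_defect /mul_defect /id_sub_tau !mulf.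
Qed.

(** * Blocks of a tensor square of a direct sum *)

Section ProductTensor.
Variables (K : fieldType) (A V : lmodType K).
Local Notation E := (A * V)%type.
Local Notation iA := (@injA K A V).
Local Notation iV := (@injV K A V).

Lemma pair_sum_inj (p : E) : p = iA p.1 + iV p.2.
Proof. by case: p => a x; congr pair; rewrite /= ?addr0 ?add0r. Qed.

Lemma tensor_blocks (t : (E ⊗ E)%type) :
  t = tmap iA iA (tmap fst fst t) + tmap iA iV (tmap fst snd t)
    + tmap iV iA (tmap snd fst t) + tmap iV iV (tmap snd snd t).
Proof.
elim/tensor_ind_pure: t => [|p q|s t IHs IHt]; first by rewrite !linear0 !addr0.
  rewrite !tmap_pure /= {1}[p]pair_sum_inj {1}[q]pair_sum_inj.
  by rewrite linearDl !linearDr /= !addrA.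
by rewrite {1}IHs {1}IHt !linearD /=; zmod.
Qed.

Lemma tensor_blocks_eq0 (t : (E ⊗ E)%type) :
  tmap fst fst t = 0 -> tmap fst snd t = 0 ->
  tmap snd fst t = 0 -> tmap snd snd t = 0 -> t = 0.
Proof.
by move=> tAA tAV tVA tVV; rewrite [t]tensor_blocks tAA tAV tVA tVV !linear0 !addr0.
Qed.

(** An antisymmetric tensor has its two mixed blocks exchanged by tau up to
    sign, so one of them is redundant. *)
Lemma skew_tensor_AV (t : (E ⊗ E)%type) :
  tau t = - t -> tmap fst snd t = 0 <-> tmap snd fst t = 0.
Proof.
move=> skew; have swap : tmap fst snd t = - tau (tmap snd fst t).
  by rewrite -tmap_tau skew linearN opprK.
rewrite swap; split=> [/eqP|->]; last by rewrite linear0 oppr0.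
by rewrite oppr_eq0 => /eqP t0; rewrite -[LHS]tauK t0 linear0.
Qed.

End ProductTensor.

(** * The compatibility conditions as blocks of the defects *)

(** The structure on E is only assumed to agree pointwise with the unified
    product and coproduct, so that the same results serve for the unified
    structure itself and for a structure on E given beforehand. *)
Section UnifiedBlocks.
Variables (K : fieldType) (A V : lmodType K).
Variables (mulA : {bilinear A -> A -> A}) (DeltaA : {linear A -> (A ⊗ A)%type}).
Variable D : extending_datum A V.
Local Notation E := (A * V)%type.
Local Notation iA := (@injA K A V).
Local Notation iV := (@injV K A V).
Variables (m : {bilinear E -> E -> E}) (Delta : {linear E -> (E ⊗ E)%type}).
Hypothesis mE : forall p q, m p q = unified_mul mulA D p q.
Hypothesis DeltaE : forall p, Delta p = unified_comul DeltaA D p.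

Let mulAA a b : m (iA a) (iA b) = (mulA a b, 0).
Proof. by rewrite mE /= !(linear0l, linear0r, linear0, addr0). Qed.
Let mulVA x b : m (iV x) (iA b) = (ed_lactA D (x ⊗ b), ed_ractV D (x ⊗ b)).
Proof. by rewrite mE /= !(linear0l, linear0r, linear0, addr0, add0r). Qed.
Let mulAV a y : m (iA a) (iV y) = (ed_ractA D (a ⊗ y), ed_lactV D (a ⊗ y)).
Proof. by rewrite mE /= !(linear0l, linear0r, linear0, addr0, add0r). Qed.
Let mulVV x y : m (iV x) (iV y) = (ed_sigma D (x ⊗ y), ed_mulV D (x ⊗ y)).
Proof. by rewrite mE /= !(linear0l, linear0r, linear0, addr0, add0r). Qed.

Let tmap_Delta (W W' : lmodType K) (h : {linear E -> W}) (k : {linear E -> W'}) a x :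
  tmap h k (Delta (a, x)) =
    tmap (h \o iA) (k \o iA) (DeltaA a)
    + (tmap (h \o iV) (k \o iV) (ed_DeltaV D x)
       + tmap (h \o iA) (k \o iV) (ed_rho D x)
       + tmap (h \o iV) (k \o iA) (ed_gamma D x)
       + tmap (h \o iA) (k \o iA) (ed_Q D x)).
Proof. by rewrite DeltaE /unified_comul !linearD /= !tmap_comp. Qed.

Let block_AA a x : tmap fst fst (Delta (a, x)) = DeltaA a + ed_Q D x.
Proof. by rewrite tmap_Delta !(tmap0l, tmap0r, tmap_idfun, add0r). Qed.
Let block_AV a x : tmap fst snd (Delta (a, x)) = ed_rho D x.
Proof. by rewrite tmap_Delta !(tmap0l, tmap0r, tmap_idfun, add0r, addr0). Qed.
Let block_VA a x : tmap snd fst (Delta (a, x)) = ed_gamma D x.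
Proof. by rewrite tmap_Delta !(tmap0l, tmap0r, tmap_idfun, add0r, addr0). Qed.
Let block_VV a x : tmap snd snd (Delta (a, x)) = ed_DeltaV D x.
Proof. by rewrite tmap_Delta !(tmap0l, tmap0r, tmap_idfun, add0r, addr0). Qed.

(** In each term of a defect the product acts on one tensor factor of a
    coproduct only, and the other factor is merely projected: these are the
    corresponding slices of the coproduct of E. *)
Section Slices.
Variables (W : lmodType K) (h : {linear E -> W}).

Lemma slice_fstA a : tmap h fst (Delta (iA a)) = tmap (h \o iA) idfun (DeltaA a).
Proof. by rewrite tmap_Delta !linear0 !addr0. Qed.
Lemma slice_sndA a : tmap h snd (Delta (iA a)) = 0.
Proof. by rewrite tmap_Delta !linear0 !addr0 tmap0r. Qed.
Lemma slice_fstV x : tmap h fst (Delta (iV x)) =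
  tmap (h \o iV) idfun (ed_gamma D x) + tmap (h \o iA) idfun (ed_Q D x).
Proof. by rewrite tmap_Delta !linear0 !(tmap0r, add0r). Qed.
Lemma slice_sndV x : tmap h snd (Delta (iV x)) =
  tmap (h \o iV) idfun (ed_DeltaV D x) + tmap (h \o iA) idfun (ed_rho D x).
Proof. by rewrite tmap_Delta !linear0 !(tmap0r, add0r, addr0). Qed.
Lemma fst_sliceA a : tmap fst h (Delta (iA a)) = tmap idfun (h \o iA) (DeltaA a).
Proof. by rewrite tmap_Delta !linear0 !addr0. Qed.
Lemma snd_sliceA a : tmap snd h (Delta (iA a)) = 0.
Proof. by rewrite tmap_Delta !linear0 !addr0 tmap0l. Qed.
Lemma fst_sliceV x : tmap fst h (Delta (iV x)) =
  tmap idfun (h \o iV) (ed_rho D x) + tmap idfun (h \o iA) (ed_Q D x).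
Proof. by rewrite tmap_Delta !linear0 !(tmap0l, add0r, addr0). Qed.
Lemma snd_sliceV x : tmap snd h (Delta (iV x)) =
  tmap idfun (h \o iV) (ed_DeltaV D x) + tmap idfun (h \o iA) (ed_gamma D x).
Proof. by rewrite tmap_Delta !linear0 !(tmap0l, add0r, addr0). Qed.

Definition slice_A := (slice_fstA, slice_sndA, fst_sliceA, snd_sliceA).
Definition slice_V := (slice_fstV, slice_sndV, fst_sliceV, snd_sliceV).
End Slices.

(** The matrix coefficients of left and right multiplication on A ⊕ V. *)
Let lmulA_fstA a : fst \o lmul m (iA a) \o iA = fun b => mulA a b.
Proof. by apply: funext => b; rewrite /= /lmul mulAA. Qed.
Let lmulA_sndA a : snd \o lmul m (iA a) \o iA = fun=> 0.
Proof. by apply: funext => b; rewrite /= /lmul mulAA. Qed.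
Let lmulA_fstV a : fst \o lmul m (iA a) \o iV = fun y => ed_ractA D (a ⊗ y).
Proof. by apply: funext => y; rewrite /= /lmul mulAV. Qed.
Let lmulA_sndV a : snd \o lmul m (iA a) \o iV = fun y => ed_lactV D (a ⊗ y).
Proof. by apply: funext => y; rewrite /= /lmul mulAV. Qed.
Let lmulV_fstA x : fst \o lmul m (iV x) \o iA = fun b => ed_lactA D (x ⊗ b).
Proof. by apply: funext => b; rewrite /= /lmul mulVA. Qed.
Let lmulV_sndA x : snd \o lmul m (iV x) \o iA = fun b => ed_ractV D (x ⊗ b).
Proof. by apply: funext => b; rewrite /= /lmul mulVA. Qed.
Let lmulV_fstV x : fst \o lmul m (iV x) \o iV = fun y => ed_sigma D (x ⊗ y).
Proof. by apply: funext => y; rewrite /= /lmul mulVV. Qed.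
Let lmulV_sndV x : snd \o lmul m (iV x) \o iV = fun y => ed_mulV D (x ⊗ y).
Proof. by apply: funext => y; rewrite /= /lmul mulVV. Qed.
Let rmulA_fstA a : fst \o rmul m (iA a) \o iA = fun b => mulA b a.
Proof. by apply: funext => b; rewrite /= /rmul mulAA. Qed.
Let rmulA_sndA a : snd \o rmul m (iA a) \o iA = fun=> 0.
Proof. by apply: funext => b; rewrite /= /rmul mulAA. Qed.
Let rmulA_fstV a : fst \o rmul m (iA a) \o iV = fun y => ed_lactA D (y ⊗ a).
Proof. by apply: funext => y; rewrite /= /rmul mulVA. Qed.
Let rmulA_sndV a : snd \o rmul m (iA a) \o iV = fun y => ed_ractV D (y ⊗ a).
Proof. by apply: funext => y; rewrite /= /rmul mulVA. Qed.
Let rmulV_fstA x : fst \o rmul m (iV x) \o iA = fun b => ed_ractA D (b ⊗ x).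
Proof. by apply: funext => b; rewrite /= /rmul mulAV. Qed.
Let rmulV_sndA x : snd \o rmul m (iV x) \o iA = fun b => ed_lactV D (b ⊗ x).
Proof. by apply: funext => b; rewrite /= /rmul mulAV. Qed.
Let rmulV_fstV x : fst \o rmul m (iV x) \o iV = fun y => ed_sigma D (y ⊗ x).
Proof. by apply: funext => y; rewrite /= /rmul mulVV. Qed.
Let rmulV_sndV x : snd \o rmul m (iV x) \o iV = fun y => ed_mulV D (y ⊗ x).
Proof. by apply: funext => y; rewrite /= /rmul mulVV. Qed.

Let coordA := (tmap0l, tmap0r, lmulA_fstA, lmulA_sndA, lmulA_fstV, lmulA_sndV,
  rmulA_fstA, rmulA_sndA, rmulA_fstV, rmulA_sndV).
Let coordV := (tmap0l, tmap0r, lmulV_fstA, lmulV_sndA, lmulV_fstV, lmulV_sndV,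
  rmulV_fstA, rmulV_sndA, rmulV_fstV, rmulV_sndV).

Let pushE := (linearB DeltaA, linearB (ed_rho D), linearB (ed_gamma D),
  linearB (ed_Q D), linearB (ed_DeltaV D)).

(* block_simp expands a block of a defect into operations of the datum, and
   compat_simp splits the sums in a compatibility condition.  Then the
   difference of the sides of the condition is the block, term by term. *)
Ltac block_simp :=
  rewrite ?tmap_comm_defect ?tmap_mul_defect ?tmap_comm_half
    ?tmap_mul_half ?mulVV ?mulVA ?mulAV
    ?block_AA ?block_AV ?block_VA ?block_VV ?slice_V ?slice_A ?coordV ?coordA.
Ltac compat_simp :=
  rewrite /commutator ?tmapBr /id_sub_tau ?pushE ?(tauD, tauN, tau0).
Ltac to_block H :=
  block_simp; move: H; apply: eq_of_subr; compat_simp; zmod.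
Ltac of_block H :=
  move: H; block_simp; rewrite ?tmap0; apply: eq_of_subr; compat_simp; zmod.

(** In each condition the difference of the two sides is one block of one
    defect.  The commutator defect yields one condition from each of its four
    blocks on V x A and on V x V; the multiplication defect yields one from its
    block in A ⊗ A, one from its block in V ⊗ V and one from a mixed block, on
    each of V x A, A x V and V x V. *)
Lemma unified_compat_defects :
  unified_compat mulA DeltaA D <->
  [/\ forall x b, comm_defect m Delta (iV x) (iA b) = 0,
      forall x y, comm_defect m Delta (iV x) (iV y) = 0,
      forall x b, mul_defect m Delta (iV x) (iA b) = 0,
      forall a y, mul_defect m Delta (iA a) (iV y) = 0
    & forall x y, mul_defect m Delta (iV x) (iV y) = 0].
Proof.
split=> [H|[CVA CVV MVA MAV MVV]].
  split=> [x b|x y|x b|a y|x y].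
  - apply: tensor_blocks_eq0.
    + to_block (unified_compat3 H x b).
    + to_block (unified_compat7 H x b).
    + to_block (unified_compat6 H x b).
    (* unified_compat4 is the block in V ⊗ V with the opposite sign *)
    + to_block (esym (unified_compat4 H b x)).
  - apply: tensor_blocks_eq0.
    + to_block (unified_compat5 H x y).
    + to_block (unified_compat1 H x y).
    + to_block (unified_compat2 H x y).
    + to_block (unified_compat16 H x y).
  - have skew := tau_mul_defect m Delta (iV x) (iA b).
    have VA0 : tmap snd fst (mul_defect m Delta (iV x) (iA b)) = 0.
      to_block (unified_compat14 H x b).
    apply: tensor_blocks_eq0; [| exact/(skew_tensor_AV skew) | exact: VA0 |].
    + to_block (unified_compat9 H x b).
    (* unified_compat12 has the flip tau already applied inside the sum *)
    + have E12 := unified_compat12 H x b.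
      rewrite -(tau_tmap idfun (fun y => ed_ractV D (y ⊗ b))) in E12.
      to_block E12.
  - have skew := tau_mul_defect m Delta (iA a) (iV y).
    have AV0 : tmap fst snd (mul_defect m Delta (iA a) (iV y)) = 0.
      to_block (unified_compat15 H a y).
    apply: tensor_blocks_eq0; [| exact: AV0 | exact/(skew_tensor_AV skew) |].
    + to_block (unified_compat10 H a y).
    + to_block (unified_compat11 H a y).
  - have skew := tau_mul_defect m Delta (iV x) (iV y).
    have AV0 : tmap fst snd (mul_defect m Delta (iV x) (iV y)) = 0.
      to_block (unified_compat8 H x y).
    apply: tensor_blocks_eq0; [| exact: AV0 | exact/(skew_tensor_AV skew) |].
    + to_block (unified_compat13 H x y).
    + to_block (unified_compat17 H x y).
split.
- move=> x y; of_block (congr1 (tmap fst snd) (CVV x y)).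
- move=> x y; of_block (congr1 (tmap snd fst) (CVV x y)).
- move=> x b; of_block (congr1 (tmap fst fst) (CVA x b)).
- move=> a y; apply: esym; of_block (congr1 (tmap snd snd) (CVA y a)).
- move=> x y; of_block (congr1 (tmap fst fst) (CVV x y)).
- move=> x b; of_block (congr1 (tmap snd fst) (CVA x b)).
- move=> x b; of_block (congr1 (tmap fst snd) (CVA x b)).
- move=> x y; of_block (congr1 (tmap fst snd) (MVV x y)).
- move=> x b; of_block (congr1 (tmap fst fst) (MVA x b)).
- move=> a y; of_block (congr1 (tmap fst fst) (MAV a y)).
- move=> a y; of_block (congr1 (tmap snd snd) (MAV a y)).
- move=> x b; rewrite -(tau_tmap idfun (fun y => ed_ractV D (y ⊗ b))).
  of_block (congr1 (tmap snd snd) (MVA x b)).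
- move=> x y; of_block (congr1 (tmap fst fst) (MVV x y)).
- move=> x b; of_block (congr1 (tmap snd fst) (MVA x b)).
- move=> a y; of_block (congr1 (tmap fst snd) (MAV a y)).
- move=> x y; of_block (congr1 (tmap snd snd) (CVV x y)).
- move=> x y; of_block (congr1 (tmap snd snd) (MVV x y)).
Qed.

Lemma unified_bialgebraP (bialgA : ls_bialgebra mulA DeltaA) :
  ls_bialgebra m Delta <->
  [/\ ls_algebra m, ls_coalgebra Delta & unified_compat mulA DeltaA D].
Proof.
have [_ _ commA mulA0] := (ls_bialgebraE mulA DeltaA).1 bialgA.
have iM : ls_algebra_hom mulA m iA by move=> a b; rewrite mulAA.
have iD : ls_coalgebra_hom DeltaA Delta iA.
  by move=> a; rewrite DeltaE /= !linear0 !addr0.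
have CAA a b : comm_defect m Delta (iA a) (iA b) = 0.
  by rewrite (defects_hom iM iD a b).1 commA tmap0.
have MAA a b : mul_defect m Delta (iA a) (iA b) = 0.
  by rewrite (defects_hom iM iD a b).2 mulA0 tmap0.
split=> [/ls_bialgebraE[alg coalg C M]|[alg coalg]].
  by split=> //; apply/unified_compat_defects; split.
move=> /unified_compat_defects[CVA CVV MVA MAV MVV].
apply/ls_bialgebraE; split=> // p q; rewrite [p]pair_sum_inj [q]pair_sum_inj.
  rewrite comm_defectDl !comm_defectDr CAA CVA CVV.
  by rewrite (comm_defectC m Delta (iV q.2)) CVA oppr0 !addr0.
by rewrite mul_defectDl !mul_defectDr MAA MAV MVA MVV !addr0.
Qed.

Lemma ls_algebra_unified : ls_algebra m <-> ls_algebra (unified_mul mulA D).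
Proof.
split=> assoc a b c; have := assoc a b c; first by rewrite !mE.
by rewrite !mE.
Qed.

Lemma ls_coalgebra_unified :
  ls_coalgebra Delta <-> ls_coalgebra (unified_comul DeltaA D).
Proof.
have eqD : Delta = unified_comul DeltaA D :> (E -> _) by apply: funext.
by rewrite /ls_coalgebra /= eqD; split.
Qed.

End UnifiedBlocks.

(** * Recovering the datum from a structure on the direct sum *)

Section Restriction.
Variables (K : fieldType) (A V : lmodType K).
Local Notation E := (A * V)%type.
Local Notation iA := (@injA K A V).
Local Notation iV := (@injV K A V).
Variables (m : {bilinear E -> E -> E}) (Delta : {linear E -> (E ⊗ E)%type}).

Section MulBlock.
Variables (U U' W : lmodType K).
Variables (f : {linear U -> E}) (g : {linear U' -> E}) (h : {linear E -> W}).

Definition mul_block (t : U ⊗ U') : W := \tsum_(u , v <- t) h (m (f u) (g v)).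

Let mul_block_bilinear : bilinear_for *:%R *:%R (fun u v => h (m (f u) (g v))).
Proof.
by split=> [v|u] k x y; rewrite linearP (linearPl, linearPr) linearP.
Qed.

Lemma mul_block_linear : linear mul_block.
Proof. exact: tlift_linear mul_block_bilinear. Qed.

HB.instance Definition _ :=
  GRing.isLinear.Build K (U ⊗ U')%type W _ mul_block mul_block_linear.

Lemma mul_blockE u v : mul_block (u ⊗ v) = h (m (f u) (g v)).
Proof. exact: tliftE. Qed.

End MulBlock.

Definition comul_block (W W' : lmodType K) (f : {linear E -> W})
  (g : {linear E -> W'}) (x : V) : W ⊗ W' := tmap f g (Delta (iV x)).

Lemma comul_block_linear (W W' : lmodType K) (f : {linear E -> W})
  (g : {linear E -> W'}) : linear (comul_block f g).
Proof. by move=> k x y; rewrite /comul_block !linearP. Qed.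

HB.instance Definition _ (W W' : lmodType K) (f : {linear E -> W})
    (g : {linear E -> W'}) :=
  GRing.isLinear.Build K V (W ⊗ W')%type _ (comul_block f g)
    (comul_block_linear f g).

Definition restricted_datum : extending_datum A V := {|
  ed_lactA := mul_block iV iA fst;
  ed_ractA := mul_block iA iV fst;
  ed_ractV := mul_block iV iA snd;
  ed_lactV := mul_block iA iV snd;
  ed_sigma := mul_block iV iV fst;
  ed_mulV := mul_block iV iV snd;
  ed_rho := comul_block fst snd;
  ed_gamma := comul_block snd fst;
  ed_Q := comul_block fst fst;
  ed_DeltaV := comul_block snd snd |}.

Variables (mulA : {bilinear A -> A -> A}) (DeltaA : {linear A -> (A ⊗ A)%type}).

(** The homomorphism hypothesis says that the product of two elements of A has
    the product of A as first component and no component in V; every other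
    component is an operation of the datum by construction. *)
Lemma restricted_mul : ls_algebra_hom mulA m iA ->
  forall p q, m p q = unified_mul mulA restricted_datum p q.
Proof.
move=> iM [a x] [b y].
rewrite [(a, x) in LHS]pair_sum_inj [(b, y) in LHS]pair_sum_inj linearDl !linearDr -iM /=.
rewrite !mul_blockE.
by congr pair => /=; zmod.
Qed.

Lemma restricted_comul : ls_coalgebra_hom DeltaA Delta iA ->
  forall p, Delta p = unified_comul DeltaA restricted_datum p.
Proof.
move=> iD [a x]; rewrite [(a, x) in LHS]pair_sum_inj linearD iD /=.
by rewrite [Delta (iV x)]tensor_blocks /comul_block; zmod.
Qed.

End Restriction.

Theorem theorem5p16 (K : fieldType) (charK0 : [pchar K] =i pred0)
    (A V : lmodType K) (mulA : {bilinear A -> A -> A})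
    (DeltaA : {linear A -> (A ⊗ A)%type})
    (bialgA : ls_bialgebra mulA DeltaA) :
  (forall D : extending_datum A V,
     ls_bialgebra (unified_mul mulA D) (unified_comul DeltaA D) <->
     [/\ ls_algebra (unified_mul mulA D),
         ls_coalgebra (unified_comul DeltaA D)
       & unified_compat mulA DeltaA D]) /\
  (forall (mulE : {bilinear (A * V)%type -> (A * V)%type -> (A * V)%type})
          (DeltaE : {linear (A * V)%type -> ((A * V) ⊗ (A * V))%type}),
     ls_bialgebra mulE DeltaE ->
     ls_algebra_hom mulA mulE (@injA K A V) ->
     ls_coalgebra_hom DeltaA DeltaE (@injA K A V) ->
     exists D : extending_datum A V,
       [/\ (forall p q : A * V, mulE p q = unified_mul mulA D p q),
           (forall p : A * V, DeltaE p = unified_comul DeltaA D p),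
           ls_algebra (unified_mul mulA D),
           ls_coalgebra (unified_comul DeltaA D)
         & unified_compat mulA DeltaA D]).
Proof.
split=> [D|mulE DeltaE bialgE iM iD]; first exact: unified_bialgebraP.
have mE := restricted_mul DeltaE iM; have dE := restricted_comul mulE iD.
exists (restricted_datum mulE DeltaE).
have [alg coalg compat] := (unified_bialgebraP mE dE bialgA).1 bialgE.
split=> //; first exact/(ls_algebra_unified mE).
exact/(ls_coalgebra_unified dE).
Qed.
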